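(* Let $M$ be a positive integer and $N\ge0$. Then $$\det C_N^{[M]}(t)=\prod_{\alpha\in\mathrm{OP}(N)}\ \prod_{a\in\alpha}[M]_{t^a},\qquad [M]_x=1+x+\cdots+x^{M-1},$$ where $a$ runs over the parts of $\alpha$ with multiplicity. Equivalently, $$\det C_N^{[M]}(t)=\prod_{\alpha\in\mathrm{OP}(N)}\ \prod_{a\in\alpha}\ \prod_{\substack{d\mid M\\ d>1}}\Phi_d(t^a),$$ where $\Phi_d$ is the $d$th cyclotomic polynomial.
   Context: A strict partition is a finite sequence $\lambda=(\lambda_1>\cdots>\lambda_\ell>0)$ of integers, with $|\lambda|=\sum\lambda_i$, $\ell(\lambda)=\ell$; $\mathrm{SP}(N)$ is the set of strict partitions of $N$ and $\mathrm{OP}(N)$ the set of partitions of $N$ with all parts odd. Let $\Gamma=\mathbb{Q}[p_1,p_3,p_5,\ldots]$ be the ring of odd power sums, graded by $\deg p_n=n$, with degree-$N$ component $\Gamma_N$. The Schur $Q$-functions $Q_\lambda\in\Gamma$ are defined as follows: $q_r$ is given by $\sum_{r\ge0}q_rz^r=\exp\bigl(2\sum_{n\ge1,\ n\text{ odd}}\frac{p_n}{n}z^n\bigr)$; for $r\ge s\ge0$ let $Q_{(r,s)}=q_rq_s+2\sum_{k=1}^{s}(-1)^kq_{r+k}q_{s-k}$; in general $Q_\lambda$ is the Pfaffian of the antisymmetric matrix with entries $Q_{(\lambda_i,\lambda_j)}$ for $i<j$, where a zero part is appended to $\lambda$ if $\ell(\lambda)$ is odd (so $Q_{(r)}=q_r$,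 $Q_\varnothing=1$). $\{Q_\lambda:\lambda\in\mathrm{SP}(N)\}$ is a basis of $\Gamma_N$. For indeterminates $t,s$, let $T_{t,s}$ be the algebra automorphism of $\Gamma$ (scalars extended to $\mathbb{Q}(t,s)$) with $T_{t,s}(p_n)=\frac{1-t^n}{1-s^n}p_n$ for $n$ odd, and define $C_{\lambda\mu}(t,s)$, $\lambda,\mu\in\mathrm{SP}(N)$, by $T_{t,s}Q_\lambda=\sum_{\mu\in\mathrm{SP}(N)}C_{\lambda\mu}(t,s)Q_\mu$. For a positive integer $M$ set $C^{[M]}_{\lambda\mu}(t):=C_{\lambda\mu}(t^M,t)$ and $C_N^{[M]}(t)=(C^{[M]}_{\lambda\mu}(t))_{\lambda,\mu\in\mathrm{SP}(N)}$, rows and columns in the same fixed order. Equivalently, $\sum_{\mu}C^{[M]}_{\lambda\mu}(t)Q_\mu$ is the image of $Q_\lambda$ under the algebra map $p_n\mapsto(1+t^n+\cdots+t^{(M-1)n})p_n$ ($n$ odd). *)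

(* Defs.v *)
From Stdlib Require Import ClassicalEpsilon.
From HB Require Import structures.
From mathcomp Require Import all_boot all_order all_algebra.
From mathcomp Require Import perm generic_quotient cyclotomic finmap.
From mathcomp.multinomials Require Import monalg.

Set Implicit Arguments.
Unset Strict Implicit.
Unset Printing Implicit Defensive.

Import GRing.Theory.
Local Open Scope ring_scope.

Definition is_part (N : nat) (l : seq nat) : bool :=
  [&& sorted geq l, 0%N \notin l & sumn l == N].

(* A partition of N has at most N parts, each at most N. *)
Definition parts (N : nat) : seq (seq nat) :=
  [seq l <- [seq map val (b : seq 'I_N.+1) | b : {bseq N of 'I_N.+1}]
  | is_part N l].

Lemma mem_parts N l : (l \in parts N) = is_part N l.
Proof.
rewrite mem_filter; case: (boolP (is_part N l)) => //= /and3P[_ l0 /eqP sl].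
have sz : (size l <= N)%N.
  rewrite -sl; elim: l l0 {sl} => //= x l IH; rewrite inE negb_or eq_sym => /andP[x0 /IH].
  by rewrite -lt0n in x0; move=> le; rewrite -add1n leq_add.
have le x : x \in l -> (x < N.+1)%N.
  rewrite -sl ltnS; elim: l {l0 sl sz} => //= y l IH.
  by rewrite inE => /predU1P[->|/IH h]; [apply: leq_addr | apply: leq_trans h (leq_addl _ _)].
have szb : (size (map (@inord N) l) <= N)%N by rewrite size_map.
apply/imageP; exists (Bseq szb) => //=.
by rewrite -map_comp map_id_in // => x /le xN /=; rewrite inordK.
Qed.

Lemma uniq_parts N : uniq (parts N).
Proof.
apply: filter_uniq; rewrite map_inj_uniq ?enum_uniq // => b c /(inj_map val_inj).
exact: val_inj.
Qed.

Definition SP (N : nat) : seq (seq nat) := [seq l <- parts N | sorted gtn l].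
Definition OP (N : nat) : seq (seq nat) := [seq l <- parts N | all odd l].

(* Gam rat is Gamma; Gam K is its scalar extension to K. The variable of index i
   stands for the power sum p_(2i+1). *)
Notation Gam K := {malg K[{cmonom nat}]}.

Section SchurQ.
(* The formulas below are meant in characteristic 0. *)
Variable K : fieldType.

(* Meaningful for n odd only. *)
Definition psum (n : nat) : Gam K := << ucm n./2 >>.

(* q_r is the coefficient of z^r in exp(2 \sum_(n odd) p_n z^n / n): since the
   exponent has no constant term, only its terms of degree at most r and the
   first r + 1 terms of the exponential contribute. *)
Definition qexponent (r : nat) : {poly Gam K} :=
  \sum_(n < r.+1 | odd n) ((2%:R / n%:R) *: psum n)%:P * 'X^n.

Definition qfun (r : nat) : Gam K :=
  \sum_(k < r.+1) (k`!%:R)^-1 *: (qexponent r ^+ k)`_r.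

Definition Qpair (r s : nat) : Gam K :=
  qfun r * qfun s
    + 2%:R * \sum_(1 <= k < s.+1) (-1) ^+ k * qfun (r + k) * qfun (s - k).

(* For n even, Pf A = (2^m m!)^-1 \sum_w sgn(w) \prod_(j < m) A_(w(2j), w(2j+1))
   with m = n/2; below i = 2j is the even index and ordS i = 2j + 1. *)
Definition pfaffian (n : nat) (A : 'M[Gam K]_n) : Gam K :=
  ((2 ^ n./2 * (n./2)`!)%:R)^-1 *:
    \sum_(w : 'S_n) (-1) ^+ w * \prod_(i < n | ~~ odd i) A (w i) (w (ordS i)).

(* nth 0 l returns 0 at the extra index used when the length is odd. *)
Definition Qmatrix (l : seq nat) : 'M[Gam K]_(size l + odd (size l)) :=
  \matrix_(i, j)
    if (i < j)%N then Qpair (nth 0%N l i) (nth 0%N l j)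
    else if (j < i)%N then - Qpair (nth 0%N l j) (nth 0%N l i)
    else 0.

Definition Qfun (l : seq nat) : Gam K := pfaffian (Qmatrix l).

Section Rescale.
Variable w : nat -> K.

Definition rescale_monom (m : {cmonom nat}) : Gam K :=
  \prod_(i <- finsupp m) (w i.*2.+1 *: psum i.*2.+1) ^+ m i.

(* The K-algebra morphism of Gam K mapping p_n to w n *: p_n, n odd. *)
Definition rescale : Gam K -> Gam K := mmap (fun c : K => c%:MP) rescale_monom.

Lemma rescale_monom_mmorphism : mmorphism rescale_monom.
Proof.
have E (m : {cmonom nat}) (d : {fset nat}) : (finsupp m `<=` d)%fset ->
    rescale_monom m = \prod_(i <- d) (w i.*2.+1 *: psum i.*2.+1) ^+ m i.
  move=> le; rewrite [LHS](big_fset_incl _ le) // => i _.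
  by rewrite -cmE_neq0 negbK => /eqP ->; rewrite expr0.
split=> [m1 m2|]; last by rewrite /rescale_monom mdom1 big_seq_fset0.
rewrite (E _ (finsupp m1 `|` finsupp m2)%fset) ?mdomD //.
rewrite (E m1 _ (fsubsetUl _ (finsupp m2))) (E m2 _ (fsubsetUr (finsupp m1) _)).
by rewrite -big_split; apply: eq_bigr => i _; rewrite cmM exprD.
Qed.

HB.instance Definition _ :=
  isMultiplicative.Build {cmonom nat} (Gam K) rescale_monom
    rescale_monom_mmorphism.

HB.instance Definition _ := GRing.RMorphism.on rescale.

Lemma rescaleZ c g : rescale (c *: g) = c *: rescale g.
Proof. by rewrite /rescale mmapZ mul_malgC. Qed.

Lemma rescale_psum n : odd n -> rescale (psum n) = w n *: psum n.
Proof.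
move=> n_odd; rewrite /rescale mmapU mul1r /rescale_monom mdomU big_seq_fset1.
by rewrite cmUU expr1 -[in RHS](odd_double_half n) n_odd.
Qed.

End Rescale.

(* T_{t,s} for arbitrary scalars t, s. *)
Definition Tmap (t s : K) : Gam K -> Gam K :=
  rescale (fun n => (1 - t ^+ n) / (1 - s ^+ n)).

End SchurQ.

(* The value at x of a rational function in one variable over F: numerator over
   denominator, in lowest terms (so independent of the representative). *)
Definition ratfun_eval (F : fieldType) (f : {fraction {poly F}}) (x : F) : F :=
  let n := \n_(repr f) in let d := \d_(repr f) in
  (n %/ gcdp n d).[x] / (d %/ gcdp n d).[x].

Lemma ratfun_evalE (F : fieldType) (n d : {poly F}) (x : F) :
  d.[x] != 0 -> ratfun_eval (tofrac n / tofrac d) x = n.[x] / d.[x].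
Proof.
move=> dx0; have d0 : d != 0 by apply: contraNneq dx0 => ->; rewrite horner0.
have ->: tofrac n / tofrac d = \pi_({fraction {poly F}})%qT (Ratio n d).
  unlock FracField.tofrac; rewrite -[X in _ * X]FracField.pi_inv -[LHS]FracField.pi_mul.
  by rewrite /FracField.mulf /FracField.invf !numden_Ratio ?oner_neq0 // mulr1 mul1r.
have := FracField.equivf_l (Ratio n d); rewrite !numden_Ratio // /ratfun_eval.
have := denom_ratioP (repr (\pi_({fraction {poly F}})%qT (Ratio n d))).
set N := \n__; set D := \d__ => D0 eqND.
set g := gcdp N D; have g0 : g != 0 by rewrite gcdp_eq0 negb_and D0 orbT.
have eN : N = N %/ g * g by rewrite divpK ?dvdp_gcdl.
have eD : D = D %/ g * g by rewrite divpK ?dvdp_gcdr.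
have cop : coprimep (N %/ g) (D %/ g) by apply: coprimep_div_gcd; rewrite D0 orbT.
have eq' : N %/ g * d = D %/ g * n.
  by apply: (mulfI g0); rewrite !mulrA ![g * _]mulrC -eN -eD.
have Dx0 : (D %/ g).[x] != 0.
  have /dvdpP[e de] : D %/ g %| d.
    rewrite -(@Gauss_dvdpr _ _ (N %/ g)) 1?coprimep_sym //.
    by rewrite eq' dvdp_mulr.
  by apply: contraNneq dx0 => E; rewrite de hornerM E mulr0.
by apply/eqP; rewrite eqr_div // -!hornerM eq' mulrC.
Qed.

(* Q(t) *)
Notation Qt := {fraction {poly rat}}.

Definition tvar : Qt := tofrac 'X.

(* Q(t,s) = Q(s)(t): the variable of the inner field of fractions plays the role
   of s, the outer one that of t. *)
Notation Qts := {fraction {poly Qt}}.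

Definition t2var : Qts := tofrac 'X.
Definition s2var : Qts := tofrac (tvar%:P).

(* C_{l mu}(t,s), mu in SP(|l|): the coefficients of T_{t,s} Q_l in the basis
   (Q_mu). *)
Definition Ccoef (l : seq nat) : seq nat -> Qts :=
  epsilon (inhabits (fun=> 0)) (fun c : seq nat -> Qts =>
    Tmap t2var s2var (Qfun Qts l) = \sum_(mu <- SP (sumn l)) c mu *: Qfun Qts mu).

(* C_{l mu}(t^M,t): s is identified with the variable t of Qt and t is evaluated
   at its M-th power. *)
Definition CMcoef (M : nat) (l mu : seq nat) : Qt :=
  ratfun_eval (Ccoef l mu) (tvar ^+ M).

(* The matrix C_N^[M](t), rows and columns ordered by sp. *)
Definition CMmatrix (M : nat) (sp : seq (seq nat)) : 'M[Qt]_(size sp) :=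
  \matrix_(i, j) CMcoef M (nth [::] sp i) (nth [::] sp j).

Definition qint (M : nat) (x : Qt) : Qt := \sum_(k < M) x ^+ k.

(* Main.v *)
(* On a product of power sums p_alpha, alpha in OP(N), the map T_{t,s} acts by the
   scalar \prod_(a in alpha) (1 - t^a) / (1 - s^a), so C_N(t,s) is conjugate, by a
   constant matrix, to a diagonal matrix; at (t^M, t) the eigenvalues are the
   products of the [M]_{t^a}.

   This requires {Q_lambda} to be a basis. It spans: the Pfaffian gives
   Q_lambda = c q_lambda + (products q_mu with a larger sum of squares), where
   c <> 0 is proportional to the Pfaffian of the matrix of ones; the relation
   Q(z) Q(-z) = 1 rewrites q_r^2 by products with a larger sum of squares; and
   Newton's identities express the p_n by the q_r. It has the right cardinality
   because Glaisher's map embeds SP(N) into OP(N). *)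
Require Import Defs.
From HB Require Import structures.
From mathcomp Require Import all_boot all_order all_algebra.
From mathcomp Require Import fingroup perm cyclotomic finmap zify.
From mathcomp.multinomials Require Import monalg.

Set Implicit Arguments.
Unset Strict Implicit.
Unset Printing Implicit Defensive.

Import GRing.Theory Num.Theory.
Local Open Scope ring_scope.

(** Two points shape the argument. The coefficients of T_{t,s} Q_lambda are given only by a choice,
    so they are pinned down by linear independence of the Q_mu. Independence is not proved directly:
    spanning gives a one-sided inverse of the transition matrix to power sums, and the cardinality
    bound makes that matrix square, so the inverse is two-sided. Next, t is replaced by t^M inside
    rational functions, an operation that is not a ring morphism on all of them. The transition
    matrices are therefore built over Q(s), where t does not occur, and only then extended to
    Q(s)(t). The denominators 1 - s^a are constants there, so every coefficient is a polynomial in t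
    and its value at t^M is an ordinary polynomial evaluation. *)

(** * Glaisher's map from strict to odd partitions *)

Lemma binary_digits_inj n (b c : nat -> bool) :
  (\sum_(k < n) b k * 2 ^ k = \sum_(k < n) c k * 2 ^ k)%N ->
  forall k, (k < n)%N -> b k = c k.
Proof.
elim: n b c => [//|n IH] b c; rewrite !big_ord_recl !expn0 !muln1.
have E (d : nat -> nat) : (\sum_(i < n) d (lift ord0 i) * 2 ^ lift ord0 i =
    (\sum_(k < n) d k.+1 * 2 ^ k).*2)%N.
  rewrite -muln2 big_distrl /=; apply: eq_bigr => i _.
  by rewrite -mulnA -expnSr.
rewrite (E (fun k => nat_of_bool (b k))) (E (fun k => nat_of_bool (c k))) => eq.
have b0 : b 0%N = c 0%N.
  by have := congr1 odd eq; rewrite !oddD !odd_double !addbF !oddb.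
case=> // k; rewrite ltnS; apply: (IH (fun k => b k.+1) (fun k => c k.+1)).
by move: eq; rewrite /= b0 => /addnI /double_inj.
Qed.

Definition odd_part (x : nat) : nat := (x %/ 2 ^ logn 2 x)%N.

Lemma odd_partK x : (odd_part x * 2 ^ logn 2 x)%N = x.
Proof. by rewrite divnK ?pfactor_dvdnn. Qed.

Lemma odd_odd_part x : (0 < x)%N -> odd (odd_part x).
Proof.
move=> x0; have [m cop xE] := pfactor_coprime (isT : prime 2) x0.
by rewrite /odd_part [X in (X %/ _)%N]xE mulnK ?expn_gt0 // -coprime2n.
Qed.

Lemma logn_odd_mul o k : odd o -> logn 2 (o * 2 ^ k)%N = k.
Proof.
move=> oo; have o0 := odd_gt0 oo; rewrite lognM ?expn_gt0 // pfactorK //.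
by rewrite logn_coprime ?coprime2n.
Qed.

Lemma odd_part_odd_mul o k : odd o -> odd_part (o * 2 ^ k)%N = o.
Proof. by move=> oo; rewrite /odd_part logn_odd_mul // mulnK ?expn_gt0. Qed.

Definition glaisher (l : seq nat) : seq nat :=
  sort geq (flatten [seq nseq (2 ^ logn 2 x) (odd_part x) | x <- l]).

Lemma geq_total : total geq.
Proof. by move=> x y; apply: leq_total. Qed.

Lemma geq_trans : transitive geq.
Proof. by move=> y x z /= yx zy; apply: leq_trans zy yx. Qed.

Lemma geq_anti : antisymmetric geq.
Proof. by move=> x y /= /andP[xy yx]; apply/eqP; rewrite eqn_leq yx xy. Qed.

Lemma mem_OP N l : (l \in OP N) = [&& sorted geq l, all odd l & sumn l == N].
Proof.
rewrite mem_filter mem_parts /is_part; case al: (all odd l); last by rewrite andbF.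
rewrite /=; suff -> : 0%N \notin l by [].
by apply/negP => /(allP al).
Qed.

Lemma sorted_gtn_geq l : sorted gtn l -> sorted geq l.
Proof. by apply: sub_sorted => x y /=; apply: ltnW. Qed.

Lemma mem_SP N l : (l \in SP N) = [&& sorted gtn l, 0%N \notin l & sumn l == N].
Proof.
rewrite mem_filter mem_parts /is_part; case sl: (sorted gtn l) => //=.
by rewrite sorted_gtn_geq.
Qed.

Lemma sumn_glaisher l : sumn (glaisher l) = sumn l.
Proof.
rewrite (perm_sumn (permEl (perm_sort _ _))) sumn_flatten -map_comp; congr sumn.
by rewrite map_id_in // => x _ /=; rewrite sumn_nseq odd_partK.
Qed.

(** Only the parts o 2^k of [l] produce copies of o, 2^k of them each. As each occurs at most once,
    the multiplicity of o is written in binary with the memberships as digits. *)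
Lemma count_glaisher l n o : odd o -> uniq l -> 0%N \notin l ->
    {in l, forall x, (logn 2 x < n)%N} ->
  count_mem o (glaisher l) = (\sum_(k < n) ((o * 2 ^ k)%N \in l) * 2 ^ k)%N.
Proof.
move=> oo; rewrite (seq.permP (permEl (perm_sort _ _))) count_flatten -map_comp.
elim: l => [|x l IH] /=; first by move=> *; rewrite big1.
move=> /andP[xl ul]; rewrite inE negb_or eq_sym => /andP[x0 l0] ln.
rewrite {}IH // => [|y yl]; last by apply: ln; rewrite inE yl orbT.
rewrite count_nseq /=.
have -> : (\sum_(k < n) ((o * 2 ^ k)%N \in x :: l) * 2 ^ k =
    \sum_(k < n) ((o * 2 ^ k)%N == x) * 2 ^ k +
    \sum_(k < n) ((o * 2 ^ k)%N \in l) * 2 ^ k)%N.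
  rewrite -big_split; apply: eq_bigr => k _ /=; rewrite -mulnDl inE.
  by case: eqP => //= ->; rewrite (negPf xl).
congr addn; have xn := ln x (mem_head _ _).
rewrite (bigD1 (Ordinal xn)) //= big1 ?addn0 => [|k kx].
  congr (nat_of_bool _ * _)%N; apply/eqP/eqP => [<-|<-]; first exact: odd_partK.
  by rewrite odd_part_odd_mul.
case: eqP => // E; move: kx; rewrite -val_eqE /= -E logn_odd_mul //.
by rewrite eqxx.
Qed.

Lemma glaisher_OP N l : l \in SP N -> glaisher l \in OP N.
Proof.
rewrite mem_SP mem_OP sumn_glaisher => /and3P[_ l0 ->]; rewrite andbT.
apply/andP; split; first exact: (sort_sorted geq_total).
rewrite (perm_all _ (permEl (perm_sort _ _))); apply/allP=> y.
move=> /flatten_mapP[x xl]; rewrite mem_nseq => /andP[_ /eqP ->].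
by apply: odd_odd_part; rewrite lt0n; apply: contraNneq l0 => <-.
Qed.

Lemma glaisher_inj N : {in SP N &, injective glaisher}.
Proof.
move=> l l'; rewrite !mem_SP => /and3P[sl l0 _] /and3P[sl' l0' _] E.
have gt_trans : transitive gtn by move=> y x z /= yx zy; apply: ltn_trans zy yx.
have gt_irr : irreflexive gtn by move=> x /=; apply: ltnn.
apply: (irr_sorted_eq gt_trans gt_irr) => // x.
have ul := sorted_uniq gt_trans gt_irr sl.
have ul' := sorted_uniq gt_trans gt_irr sl'.
case: (posnP x) => [->|x0]; first by rewrite (negPf l0) (negPf l0').
have oo := odd_odd_part x0.
(* One length for both binary expansions; the sum of all the valuations bounds each of them. *)
have [n [h1 h2 h3]] : exists n, [/\ {in l, forall y, (logn 2 y < n)%N},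
    {in l', forall y, (logn 2 y < n)%N} & (logn 2 x < n)%N].
  pose s := [seq logn 2 y | y <- x :: l ++ l'].
  have H z : z \in x :: l ++ l' -> (logn 2 z < (sumn s).+1)%N.
    rewrite ltnS /s; elim: (x :: _) => //= y t IH.
    rewrite inE => /predU1P[->|/IH h]; first exact: leq_addr.
    by rewrite (leq_trans h) ?leq_addl.
  exists (sumn s).+1; split=> [y yl|y yl|]; apply: H; last exact: mem_head.
    by rewrite inE mem_cat yl orbT.
  by rewrite inE mem_cat yl !orbT.
have := congr1 (count_mem (odd_part x)) E.
rewrite !(@count_glaisher _ n) // => eq.
have := @binary_digits_inj n (fun k => (odd_part x * 2 ^ k)%N \in l)
  (fun k => (odd_part x * 2 ^ k)%N \in l') eq _ h3.
by rewrite odd_partK.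
Qed.

Lemma uniq_SP N : uniq (SP N).
Proof. by rewrite filter_uniq ?uniq_parts. Qed.

Lemma uniq_OP N : uniq (OP N).
Proof. by rewrite filter_uniq ?uniq_parts. Qed.

Lemma size_SP_le N : (size (SP N) <= size (OP N))%N.
Proof.
rewrite -(size_map glaisher); apply: uniq_leq_size.
  by rewrite map_inj_in_uniq ?uniq_SP //; apply: glaisher_inj.
by move=> _ /mapP[l lS ->]; apply: glaisher_OP.
Qed.

(* For n even, the involution exchanging 2j and 2j + 1. *)
Definition mate n (i : 'I_n) : 'I_n := if odd i then ord_pred i else ordS i.

(** * Positivity of the Pfaffian sum of the antisymmetric matrix of ones *)

Section PfaffianOfOnes.
Variables (n : nat) (n_even : ~~ odd n).
Implicit Types (i j k : 'I_n) (w : 'S_n).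

Lemma val_mate i : mate i = (if odd i then i.-1 else i.+1) :> nat.
Proof.
have := ltn_ord i; rewrite /mate; case: ifPn => oi lin /=.
  have -> : ((i + n).-1 = i.-1 + n)%N by lia.
  by rewrite modnDr modn_small //; lia.
by rewrite modn_small //; lia.
Qed.

Lemma odd_mate i : odd (mate i) = ~~ odd i.
Proof. by rewrite val_mate; case: ifPn; lia. Qed.

Lemma mateK : involutive (@mate n).
Proof.
by move=> i; apply: val_inj; rewrite /= val_mate odd_mate val_mate; case: (boolP (odd i)) => /=; lia.
Qed.

Lemma mate_inj : injective (@mate n).
Proof. exact: inv_inj mateK. Qed.

(** The antisymmetric matrix with ones above the diagonal, as signs of differences so that it can be
    compared with Vandermonde products. *)
Definition ord_sign i j : int := Num.sg (j%:Z - i%:Z).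

Lemma ord_signE i j : i != j -> ord_sign i j = if (i < j)%N then 1 else -1.
Proof.
rewrite -val_eqE /ord_sign /= => ij; case: ltnP => lt.
  by apply/gtr0_sg; lia.
by apply/ltr0_sg; lia.
Qed.

(** [i] and [mate i] are consecutive, so no third index separates them. *)
Lemma ord_sign_mate i j : j != i -> j != mate i -> ord_sign (mate i) j = ord_sign i j.
Proof.
move=> ji jm; rewrite !ord_signE 1?eq_sym //.
have -> // : (mate i < j)%N = (i < j)%N.
by move: ji jm; rewrite -!val_eqE /= val_mate; case: (boolP (odd i)) => /=; lia.
Qed.

Lemma ord_signN i j : ord_sign i j = - ord_sign j i.
Proof. by rewrite /ord_sign -sgrN opprB. Qed.

Lemma ord_sign_mater i j : j != i -> j != mate i -> ord_sign j (mate i) = ord_sign j i.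
Proof. by move=> ji jm; rewrite ord_signN ord_sign_mate // -ord_signN. Qed.


Lemma sgr_signM w (x : int) : Num.sg ((-1) ^+ w * x) = (-1) ^+ w * Num.sg x.
Proof. by rewrite sgrM sgrX sgrN1. Qed.

Lemma sgr_prod I (r : seq I) (P : pred I) (F : I -> int) :
  Num.sg (\prod_(i <- r | P i) F i) = \prod_(i <- r | P i) Num.sg (F i).
Proof. exact: (big_morph _ (@sgrM int) (@sgr1 int)). Qed.

(* Both sides are signs of Vandermonde determinants. *)
Lemma signr_perm_ord_sign w :
  \prod_(i < n) \prod_(j < n | (i < j)%N) ord_sign (w i) (w j) = (-1) ^+ w.
Proof.
pose V (a : 'rV[int]_n) := Vandermonde n a.
have detV : \det (V (\row_(i < n) (w i)%:Z)) = (-1) ^+ w * \det (V (\row_(i < n) i%:Z)).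
  rewrite -[in RHS](odd_permV w) -det_perm mulrC -det_mulmx -col_permE.
  by congr (\det _); apply/matrixP => i j; rewrite !mxE.
move: detV; rewrite !det_Vandermonde => /(congr1 Num.sg).
rewrite sgr_signM !sgr_prod => E; rewrite -[RHS]mulr1.
rewrite -[X in _ * X](_ : \prod_(i < n) Num.sg (\prod_(j < n | (i < j)%N)
    ((\row_(k < n) k%:Z) 0 j - (\row_(k < n) k%:Z) 0 i)) = 1 :> int).
  rewrite -E; apply: eq_bigr => i _; rewrite sgr_prod; apply: eq_bigr => j _.
  by rewrite !mxE.
rewrite big1 // => i _; rewrite sgr_prod big1 // => j ij.
by rewrite !mxE; apply/gtr0_sg; lia.
Qed.

Lemma mate_neq i : mate i != i.
Proof. by rewrite -val_eqE /= val_mate; case: (boolP (odd i)) => /=; lia. Qed.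

Definition pf_term w : int := \prod_(i < n | ~~ odd i) ord_sign (w i) (w (mate i)).

(** In the product of signs over all i < j, fix i. The indices j and [mate j] outside the pair of i
    contribute equal signs, because their images are again consecutive. Only the pairs (i, [mate i])
    with i even survive. *)
Lemma pf_term_mate w :
  (forall i, w (mate i) = mate (w i)) -> pf_term w = (-1) ^+ w.
Proof.
move=> Hw; rewrite -signr_perm_ord_sign /pf_term big_mkcond /=.
apply: eq_bigr => i _.
have E : \prod_(j : 'I_n | (i < j)%N && (j != mate i)) ord_sign (w i) (w j) = 1.
  rewrite (bigID (fun j : 'I_n => odd j)) /= (reindex_inj mate_inj) /=.
  rewrite [X in _ * X](eq_bigl (fun j : 'I_n =>
      (i < mate j)%N && (mate j != mate i) && odd (mate j))); last first.
    move=> j; rewrite -!val_eqE /= !val_mate.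
    by case: (boolP (odd i)); case: (boolP (odd j)) => /=; lia.
  rewrite -big_split big1 //= => j; rewrite odd_mate => /andP[/andP[ij jmi] oj].
  have ji : w i != w j.
    by rewrite (inj_eq perm_inj); apply: contraNneq jmi => ->.
  rewrite Hw ord_sign_mater //; first by rewrite ord_signE //; case: ifP.
  rewrite -Hw (inj_eq perm_inj); apply: contraTneq ij => <-.
  by rewrite ltnn.
case: ifPn => oi.
  rewrite (bigD1 (mate i)) /= ?E ?mulr1 //.
  by rewrite val_mate (negPf oi).
rewrite -[LHS]E; apply: eq_bigl => j; rewrite -val_eqE /= val_mate.
by move: oi; case: (boolP (odd i)) => /=; lia.
Qed.

(** Here [i] is a value of [w], not a position: this makes the predicate invariant under the
    exchange below. *)
Definition mispaired w i : bool := w (mate (w^-1%g i)) != mate i.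

(* Exchanging in [w] the values [k] and [mate k], for [k] mispaired, is a
   sign-reversing involution. *)
Definition pf_switch w : 'S_n :=
  if [pick k | mispaired w k] is Some k then (w * tperm k (mate k))%g else w.

(** By this invariance [pick] selects the same [k] before and after the exchange, which makes
    [pf_switch] an involution. *)
Lemma mispaired_switch w k : mispaired w k ->
  mispaired (w * tperm k (mate k))%g =1 mispaired w.
Proof.
move=> bad i; rewrite /mispaired invMg tpermV !permM.
rewrite (can2_eq (tpermK k (mate k)) (tpermK k (mate k))).
have badm : mispaired w (mate k).
  rewrite /mispaired mateK; apply: contraNneq bad => eq.
  by rewrite /mispaired -{1}eq permK mateK permKV.
case: tpermP => [->|->|/eqP ik /eqP imk]; rewrite ?mateK ?tpermL ?tpermR.
- by move: bad badm; rewrite /mispaired mateK => -> ->.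
- by move: bad badm; rewrite /mispaired mateK => -> ->.
by rewrite tpermD // eq_sym ?(inj_eq mate_inj) // (inv_eq mateK).
Qed.

Lemma pf_switchK : involutive pf_switch.
Proof.
move=> w; rewrite {2}/pf_switch; case E: [pick k | mispaired w k] => [k|].
  have bad : mispaired w k by move: E; case: pickP => // k' ? [<-].
  by rewrite /pf_switch (eq_pick (mispaired_switch bad)) E -mulgA tperm2 mulg1.
by rewrite /pf_switch E.
Qed.

(** The transposition flips the sign of [w]. The term is unchanged: [k] and [mate k] are
    consecutive, and each is compared with a value different from both. *)
Lemma pf_switch_sign w : (exists k, mispaired w k) ->
  (-1) ^+ pf_switch w * pf_term (pf_switch w) = - ((-1) ^+ w * pf_term w).
Proof.
case=> k0 bad0; rewrite /pf_switch; case: pickP => [k bad|/(_ k0)]; last by rewrite bad0.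
rewrite odd_permM odd_tperm eq_sym mate_neq signr_addb expr1 mulrN1 mulNr.
congr (- (_ * _)); apply: eq_bigr => i _; rewrite !permM.
have H j : w j \in [:: k; mate k] -> w (mate j) \notin [:: k; mate k].
  rewrite !inE !negb_or.
  case/orP=> /eqP wj.
    rewrite -{1}wj (inj_eq perm_inj) mate_neq /=.
    by move: bad; rewrite /mispaired -{1}wj permK.
  rewrite -wj (inj_eq perm_inj) mate_neq andbT.
  apply: contraNneq bad => wmj.
  by rewrite /mispaired -{1}wmj permK mateK wj.
have H' j : w (mate j) \in [:: k; mate k] -> w j \notin [:: k; mate k].
  by move=> /H; rewrite mateK.
have id v : v \notin [:: k; mate k] -> tperm k (mate k) v = v.
  by rewrite !inE negb_or => /andP[? ?]; rewrite tpermD // eq_sym.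
have [ki|nki] := boolP (w i \in [:: k; mate k]).
  have nm := H _ ki; rewrite (id _ nm); move: nm; rewrite !inE negb_or => /andP[n1 n2].
  by move: ki; rewrite !inE => /orP[]/eqP ->; rewrite ?tpermL ?tpermR ord_sign_mate.
rewrite (id _ nki).
have [km|nkm] := boolP (w (mate i) \in [:: k; mate k]); last by rewrite (id _ nkm).
move: nki; rewrite !inE negb_or => /andP[n1 n2].
by move: km; rewrite !inE => /orP[]/eqP ->; rewrite ?tpermL ?tpermR ord_sign_mater.
Qed.

(** After cancellation, each [w] that commutes with [mate] contributes the square of its sign, so
    [m] counts these permutations; the identity is one of them. *)
Lemma pfaffian_ones_gt0 :
  exists2 m, (0 < m)%N & \sum_(w : 'S_n) (-1) ^+ w * pf_term w = m%:R.
Proof.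
exists #|[pred w : 'S_n | [forall i, ~~ mispaired w i]]|.
  apply/card_gt0P; exists 1%g; rewrite inE; apply/forallP => i.
  by rewrite /mispaired invg1 !perm1 eqxx.
rewrite (bigID (fun w => [forall i, ~~ mispaired w i])) /=.
set S := (X in _ + X); have S0 : S = - S.
  rewrite {1}/S (reindex_inj (inv_inj pf_switchK)) /S -sumrN.
  have E w : [exists i, mispaired (pf_switch w) i] = [exists i, mispaired w i].
    rewrite /pf_switch; case: pickP => // k bad.
    by apply: eq_existsb => i; rewrite mispaired_switch.
  have N w : (~~ [forall i, ~~ mispaired w i]) = [exists i, mispaired w i].
    by rewrite negb_forall; apply: eq_existsb => i; rewrite negbK.
  apply: eq_big => [w|w]; first by rewrite !N E.
  by rewrite N E => /existsP; apply: pf_switch_sign.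
have -> : S = 0 by lia.
rewrite addr0 (eq_bigr (fun=> 1)) ?sumr_const // => w /forallP good.
rewrite pf_term_mate ?sqrr_sign -?expr2 ?sqrr_sign // => i.
by have := good (w i); rewrite /mispaired permK negbK => /eqP.
Qed.

End PfaffianOfOnes.

(** * The generating series of the q_r, Newton's identities and the quadratic relation *)

Section GenericCoefficients.
Variable R : nzRingType.
Implicit Types p q : {poly R}.

Lemma coefX_low p k i : p`_0 = 0 -> (i < k)%N -> (p ^+ k)`_i = 0.
Proof.
move=> p0; elim: k i => // k IH i; rewrite ltnS => ik.
rewrite exprS coefM big1 // => -[[|j] /= ji] _; first by rewrite p0 mul0r.
by rewrite IH ?mulr0 //; move: ji; rewrite ltnS; lia.
Qed.

Lemma coefM_eq p p' q q' N : (forall i, (i < N)%N -> p`_i = p'`_i) ->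
  (forall i, (i < N)%N -> q`_i = q'`_i) ->
  forall i, (i < N)%N -> (p * q)`_i = (p' * q')`_i.
Proof.
move=> ep eq i iN; rewrite !coefM; apply: eq_bigr => j _.
by rewrite ep ?eq //; have := ltn_ord j; lia.
Qed.

Lemma coefX_eq p p' k N : (forall i, (i < N)%N -> p`_i = p'`_i) ->
  forall i, (i < N)%N -> (p ^+ k)`_i = (p' ^+ k)`_i.
Proof.
by move=> ep; elim: k => // k IH i; rewrite !exprS; apply: coefM_eq.
Qed.

End GenericCoefficients.

Section Newton.
Variables (K : fieldType) (R : comAlgType K) (p : nat -> R).
Hypothesis charK : [pchar K] =i pred0.

(* [qexponent] and [qfun] in an arbitrary commutative algebra. *)
Definition odd_exponent (r : nat) : {poly R} :=
  \sum_(n < r.+1 | odd n) ((2%:R / n%:R) *: p n)%:P * 'X^n.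

Definition odd_exp_coef (r : nat) : R :=
  \sum_(k < r.+1) (k`!%:R)^-1 *: (odd_exponent r ^+ k)`_r.

Lemma natf_neq0_pchar0 n : (0 < n)%N -> n%:R != 0 :> K.
Proof. by move=> n0; rewrite (proj1 (pcharf0P K) charK) -lt0n. Qed.

Lemma coef_odd_exponent r i :
  (odd_exponent r)`_i = if (i <= r)%N && odd i then (2%:R / i%:R) *: p i else 0.
Proof.
rewrite /odd_exponent coef_sum.
under eq_bigr => n _ do rewrite coefCM coefXn.
case: ifPn => [/andP[ir oi]|nri].
  have ir' : (i < r.+1)%N by [].
  rewrite (bigD1 (Ordinal ir')) //= eqxx mulr1 big1 ?addr0 // => j /andP[_].
  by rewrite -val_eqE /= eq_sym => /negPf ->; rewrite mulr0.
rewrite big1 // => j oj; case: eqP => [ij|]; last by rewrite mulr0.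
by move: nri; rewrite ij oj andbT -ltnS ltn_ord.
Qed.

(** Each q_r is defined with its own truncation; this single polynomial has q_0, ..., q_N as its
    first coefficients, so it can be differentiated. *)
Definition odd_exp_series N : {poly R} :=
  \sum_(k < N.+1) ((k`!%:R)^-1)%:A *: odd_exponent N ^+ k.

Lemma coef_odd_exp_series N r : (r <= N)%N -> (odd_exp_series N)`_r = odd_exp_coef r.
Proof.
move=> rN; rewrite /odd_exp_series /odd_exp_coef coef_sum.
rewrite -(big_mkord xpredT (fun k => ((k`!%:R)^-1%:A *: odd_exponent N ^+ k)`_r)).
rewrite (big_cat_nat (n := r.+1)) //= [X in _ + X]big_nat [X in _ + X]big1; last first.
  by move=> k /andP[rk _]; rewrite coefZ coefX_low ?mulr0 ?coef_odd_exponent.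
rewrite addr0 big_mkord; apply: eq_bigr => k _; rewrite coefZ mulr_algl; congr (_ *: _).
apply: (@coefX_eq _ _ _ _ r.+1) => // i; rewrite ltnS => ir.
by rewrite !coef_odd_exponent ir (leq_trans ir rN).
Qed.

(** Truncated form of Q' = E' Q for the exponent E. The subtracted top term E^N / N! has no
    coefficient below degree N. *)
Lemma deriv_odd_exp_series N : (odd_exp_series N)^`() = (odd_exponent N)^`() *
  (odd_exp_series N - ((N`!%:R)^-1)%:A *: odd_exponent N ^+ N).
Proof.
rewrite {2}/odd_exp_series big_ord_recr /= addrK /odd_exp_series big_ord_recl.
rewrite derivD expr0 alg_polyC derivC add0r raddf_sum mulr_sumr /=.
apply: eq_bigr => k _; rewrite derivZ deriv_exp /bump /= add1n /=.
rewrite -scaler_nat scalerA -scalerAr; congr (_ *: _).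
rewrite mulr_algl -[k.+1%:R](scaler_nat k.+1 (1 : R)) scalerA; congr (_ *: _).
rewrite factS natrM invfM mulrAC mulVf ?mul1r //.
exact: natf_neq0_pchar0.
Qed.

Lemma odd_exp_coef0 : odd_exp_coef 0 = 1.
Proof.
by rewrite /odd_exp_coef big_ord1 expr0 coef1 eqxx fact0 invr1 scale1r.
Qed.

Lemma odd_exp_coef_newton n :
  n.+1%:R *: odd_exp_coef n.+1 = 2%:R *: \sum_(i < n.+1 | ~~ odd i) p i.+1 * odd_exp_coef (n - i).
Proof.
(* Degree n of the derivative needs q_(n+1), hence the truncation at n + 1; the error term then
   starts above degree n. *)
have := congr1 (fun u : {poly R} => u`_n) (deriv_odd_exp_series n.+1).
rewrite /= coef_deriv coef_odd_exp_series // -scaler_nat => ->.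
rewrite coefM scaler_sumr [RHS]big_mkcond /=; apply: eq_bigr => i _.
have ni : (n - i < n.+1)%N by rewrite ltnS leq_subr.
rewrite coefB coefZ coefX_low ?coef_odd_exponent // mulr0 subr0.
rewrite coef_odd_exp_series ?(ltnW ni) // coef_deriv coef_odd_exponent ltn_ord /=.
case: ifP => oi; last by rewrite mul0rn mul0r.
rewrite -scaler_nat scalerA -scalerAl; congr (_ *: _).
by rewrite mulrCA divff ?mulr1 //; apply: natf_neq0_pchar0.
Qed.

(* The coefficientwise form of Q(z) Q(-z) = 1, obtained from the vanishing of
   the derivative of the left-hand side. *)
Lemma odd_exp_coef_quadratic n : (0 < n)%N ->
  \sum_(i < n.+1) (-1) ^+ i * odd_exp_coef i * odd_exp_coef (n - i) = 0.
Proof.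
move=> n0; set f := LHS.
(* [P] and [M] truncate Q(z) and Q(-z), and [D] truncates Q'/Q. As [D] is even in z, the derivative
   of Q(-z) is -D Q(-z). *)
pose P := \poly_(i < n.+1) odd_exp_coef i.
pose M := \poly_(i < n.+1) ((-1) ^+ i * odd_exp_coef i).
pose D := \poly_(i < n.+1) (if odd i then 0 else 2%:R *: p i.+1).
have eP i : (i < n)%N -> P^`()`_i = (D * P)`_i.
  move=> lin; rewrite coef_deriv coef_poly ltnS lin -scaler_nat odd_exp_coef_newton.
  rewrite coefM scaler_sumr big_mkcond /=; apply: eq_bigr => j _.
  have := ltn_ord j; rewrite ltnS => ji.
  rewrite !coef_poly ltnS ltnW ?(leq_ltn_trans ji) //.
  rewrite ltnS (leq_trans (leq_subr _ _)) ?(ltnW lin) //.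
  by case: odd; rewrite ?mul0r // scalerAl.
have eM i : (i < n)%N -> M^`()`_i = (- D * M)`_i.
  move=> lin; rewrite coef_deriv coef_poly ltnS lin -mulrnAr -scaler_nat odd_exp_coef_newton.
  rewrite mulNr coefN coefM scaler_sumr big_mkcond mulr_sumr -sumrN /=.
  apply: eq_bigr => j _.
  have := ltn_ord j; rewrite ltnS => ji.
  rewrite !coef_poly ltnS ltnW ?(leq_ltn_trans ji) //.
  rewrite ltnS (leq_trans (leq_subr _ _)) ?(ltnW lin) //.
  case: (boolP (odd j)) => oj; rewrite ?mul0r ?mulr0 ?oppr0 //=.
  have -> : (-1) ^+ i.+1 = - (-1) ^+ (i - j) :> R.
    rewrite -signr_odd -[in RHS]signr_odd oddB // (negPf oj) addbF /=.
    by case: odd; rewrite ?expr0 ?expr1 ?opprK.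
  by rewrite mulNr -scalerAr -scalerAl mulrCA.
have : ((P * M)^`())`_n.-1 = 0.
  have nn : (n.-1 < n)%N by rewrite prednK.
  rewrite derivM coefD (coefM_eq eP (fun i _ => erefl (M`_i)) nn).
  rewrite (coefM_eq (fun i _ => erefl (P`_i)) eM nn) -coefD.
  by rewrite mulNr mulrN mulrA [P * D]mulrC addrN coef0.
rewrite coef_deriv prednK // -scaler_nat => /eqP.
rewrite scaler_eq0 (negPf (natf_neq0_pchar0 n0)) /= => /eqP.
rewrite coefMr => <-; rewrite /f; apply: eq_bigr => i _.
have := ltn_ord i; rewrite ltnS => lin.
by rewrite !coef_poly ltn_ord ltnS leq_subr mulrC.
Qed.


End Newton.

(** * Spans of products, filtered by the sum of squares *)

(** A numerical stand-in for dominance order: it grows strictly when r >= s become r + k and s - k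
    with k > 0, is additive under concatenation, and is bounded for a fixed sum. *)
Definition sumsq (s : seq nat) : nat := sumn [seq (a ^ 2)%N | a <- s].

Section WeightedSpan.
Variables (K : fieldType) (R : comAlgType K).
Implicit Types (f : nat -> R) (P : pred nat) (W d : nat) (g h : R) (s : seq nat).

(* The linear combinations of products of [f] over sequences of sum [W] with
   entries in [P] and sum of squares at least [d]. *)
Definition wspan f P W d g : Prop :=
  exists l : seq (K * seq nat),
    all (fun x => [&& all P x.2, sumn x.2 == W & (d <= sumsq x.2)%N]) l /\
    g = \sum_(x <- l) x.1 *: \prod_(a <- x.2) f a.

Section Closure.
Variables (f : nat -> R) (P : pred nat).

Lemma wspan_seq s d : all P s -> (d <= sumsq s)%N ->
  wspan f P (sumn s) d (\prod_(a <- s) f a).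
Proof.
move=> Ps ds; exists [:: (1, s)]; split; first by rewrite /= Ps eqxx ds.
by rewrite big_seq1 scale1r.
Qed.

Lemma wspan0 W d : wspan f P W d 0.
Proof. by exists [::]; rewrite big_nil. Qed.

Lemma wspanD W d g h : wspan f P W d g -> wspan f P W d h -> wspan f P W d (g + h).
Proof.
move=> [l [al ->]] [m [am ->]]; exists (l ++ m); rewrite all_cat al am.
by rewrite big_cat.
Qed.

Lemma wspanZ W d c g : wspan f P W d g -> wspan f P W d (c *: g).
Proof.
move=> [l [al ->]]; exists [seq (c * x.1, x.2) | x <- l]; split.
  by rewrite all_map.
by rewrite big_map scaler_sumr; apply: eq_bigr => x _; rewrite scalerA.
Qed.

Lemma wspanN W d g : wspan f P W d g -> wspan f P W d (- g).
Proof. by rewrite -scaleN1r; apply: wspanZ. Qed.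

Lemma wspanB W d g h : wspan f P W d g -> wspan f P W d h -> wspan f P W d (g - h).
Proof. by move=> hg hh; apply: wspanD => //; apply: wspanN. Qed.

Lemma wspan_sum W d I (r : seq I) (Q : pred I) (g : I -> R) :
  (forall i, Q i -> wspan f P W d (g i)) -> wspan f P W d (\sum_(i <- r | Q i) g i).
Proof.
by move=> hg; elim/big_rec: _ => [|i h Qi]; [exact: wspan0 | apply/wspanD/hg].
Qed.

Lemma wspan_le W d e g : (d <= e)%N -> wspan f P W e g -> wspan f P W d g.
Proof.
move=> de [l [al ->]]; exists l; split=> //; apply: sub_all al => x /and3P[-> ->].
exact: leq_trans.
Qed.

Lemma wspan1 : wspan f P 0 0 1.
Proof. by have := @wspan_seq [::] 0 isT isT; rewrite big_nil. Qed.

Lemma wspan_gen n : P n -> wspan f P n (n ^ 2) (f n).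
Proof.
move=> Pn; have := @wspan_seq [:: n] (n ^ 2); rewrite /sumsq /= !addn0 big_seq1.
by apply; rewrite ?Pn.
Qed.

Lemma wspanM W d V e g h : wspan f P W d g -> wspan f P V e h ->
  wspan f P (W + V) (d + e) (g * h).
Proof.
move=> [l [al ->]] [m [am ->]].
exists [seq (x.1 * y.1, x.2 ++ y.2) | x <- l, y <- m]; split.
  apply/allP => _ /allpairsP[[x y] /= [/(allP al) /and3P[Px /eqP Wx dx]
    /(allP am) /and3P[Py /eqP Vy ey] ->]].
  by rewrite /sumsq all_cat Px Py map_cat !sumn_cat Wx Vy eqxx leq_add.
rewrite big_allpairs_dep mulr_suml /=; apply: eq_bigr => x _.
rewrite mulr_sumr; apply: eq_bigr => y _ /=.
by rewrite big_cat -scalerAl -scalerAr scalerA.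
Qed.

Lemma wspan_prod I (r : seq I) (Q : pred I) (W d : I -> nat) (g : I -> R) :
  (forall i, Q i -> wspan f P (W i) (d i) (g i)) ->
  wspan f P (\sum_(i <- r | Q i) W i) (\sum_(i <- r | Q i) d i)
    (\prod_(i <- r | Q i) g i).
Proof.
move=> H; elim: r => [|i r IH]; first by rewrite !big_nil; apply: wspan1.
by rewrite !big_cons; case: ifP => // Qi; apply: wspanM => //; apply: H.
Qed.

(* A product is determined modulo higher terms by the leading terms of its
   factors. *)
Lemma wspan_prod_lead I (r : seq I) (Q : pred I) (W d : I -> nat) (c : I -> K)
    (g h : I -> R) :
  (forall i, Q i -> wspan f P (W i) (d i) (h i)) ->
  (forall i, Q i -> wspan f P (W i) (d i).+1 (g i - c i *: h i)) ->
  wspan f P (\sum_(i <- r | Q i) W i) (\sum_(i <- r | Q i) d i).+1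
    (\prod_(i <- r | Q i) g i
      - (\prod_(i <- r | Q i) c i) *: \prod_(i <- r | Q i) h i).
Proof.
move=> Hh Hg; elim: r => [|i r IH].
  by rewrite !big_nil scale1r subrr; apply: wspan0.
rewrite !big_cons; case: ifP => // Qi.
set g' := \prod_(j <- r | Q j) g j in IH *; set h' := \prod_(j <- r | Q j) h j in IH *.
set c' := \prod_(j <- r | Q j) c j in IH *.
have -> : g i * g' - (c i * c') *: (h i * h') =
    (g i - c i *: h i) * g' + c i *: (h i * (g' - c' *: h')).
  rewrite mulrBl mulrBr -!scalerAl -!scalerAr scalerBr scalerA.
  by rewrite addrA subrK.
have wh' : wspan f P (\sum_(j <- r | Q j) W j) (\sum_(j <- r | Q j) d j) h'.
  exact: wspan_prod.
apply: wspanD.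
  rewrite -addSn; apply: wspanM; first exact: Hg.
  rewrite -[g'](subrK (c' *: h')); apply: wspanD; last exact: wspanZ.
  exact: wspan_le IH.
by apply: wspanZ; rewrite -addnS; apply: wspanM => //; apply: Hh.
Qed.

End Closure.

Lemma wspan_trans f P f' P' W d g :
  (forall n, P n -> wspan f' P' n 0 (f n)) -> wspan f P W d g -> wspan f' P' W 0 g.
Proof.
move=> H [l [/allP al ->]]; rewrite big_seq; apply: wspan_sum => x /al.
move=> /and3P[/allP Px /eqP <- _]; apply: wspanZ.
rewrite sumnE big_seq [X in wspan _ _ _ _ X]big_seq.
have := @wspan_prod f' P' _ x.2 (fun a => a \in x.2) id (fun=> 0%N) f.
by rewrite big1_eq; apply=> a /Px /H.
Qed.

End WeightedSpan.

(** * Passing between the p_n and the q_r *)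

Section Generators.
Variables (K : fieldType) (R : comAlgType K) (p : nat -> R).
Hypothesis charK : [pchar K] =i pred0.
Local Notation q := (odd_exp_coef p).

Lemma odd_exp_coef_wspan n : wspan p odd n 0 (q n).
Proof.
elim/ltn_ind: n => -[_|n IH]; first by rewrite odd_exp_coef0; apply: wspan1.
have n0 := natf_neq0_pchar0 charK (ltn0Sn n).
rewrite -[q _](scalerK n0) odd_exp_coef_newton //.
do 2![apply: wspanZ]; apply: wspan_sum => i oi.
have E : n.+1 = (i.+1 + (n - i))%N by have := ltn_ord i; lia.
rewrite [X in wspan _ _ X]E.
apply: (@wspanM _ _ _ _ _ 0 _ 0); last by apply: IH; lia.
exact/(wspan_le (leq0n _))/wspan_gen.
Qed.

Lemma power_sum_wspan n : odd n -> wspan q predT n 0 (p n).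
Proof.
elim/ltn_ind: n => -[//|n] IH on.
have := odd_exp_coef_newton p charK n.
have n2 := natf_neq0_pchar0 charK (ltn0Sn 1).
move/(congr1 ( *:%R 2%:R^-1)); rewrite scalerK // big_mkcond big_ord_recr /=.
(* The last summand i = n is p_(n+1) q_0 = p_(n+1), so Newton's identity can be solved for it. *)
rewrite -[~~ odd n]/(odd n.+1) on subnn odd_exp_coef0 mulr1.
rewrite [X in _ = X]addrC => /(canLR (addrK _)) <-; apply: wspanB.
  by do 2![apply: wspanZ]; apply/(wspan_le (leq0n _))/wspan_gen.
apply: wspan_sum => i _; case: ifP => [oi|_]; last exact: wspan0.
have E : n.+1 = (i.+1 + (n - i))%N by have := ltn_ord i; lia.
rewrite [X in wspan _ _ X]E.
apply: (@wspanM _ _ _ _ _ 0 _ 0); last exact/(wspan_le (leq0n _))/wspan_gen.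
by apply: IH => //=; have := ltn_ord i; lia.
Qed.

(** In the quadratic relation of degree 2n the middle term is q_n^2 up to sign. The others are q_i
    q_(2n-i) with i <> n, where i^2 + (2n-i)^2 = 2n^2 + 2(n-i)^2 is larger. *)
Lemma odd_exp_coef_square_wspan n : (0 < n)%N ->
  wspan q predT (n + n) (n ^ 2 + n ^ 2).+1 (q n * q n).
Proof.
move=> n0; have nn : (n < (n + n).+1)%N by lia.
have := odd_exp_coef_quadratic p charK (n := (n + n)%N).
rewrite addn_gt0 n0 => /(_ isT); rewrite (bigD1 (Ordinal nn)) //= addnK.
rewrite -mulrA => /(congr1 ( *%R ((-1) ^+ n))); rewrite mulr0 mulrDr mulrA -expr2 sqrr_sign mul1r.
move/(canRL (addrK _)) ->; rewrite sub0r; apply: wspanN.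
rewrite mulr_sumr; apply: wspan_sum => i ni.
have W : wspan q predT (n + n) (n ^ 2 + n ^ 2).+1 (q i * q (n + n - i)).
  have E : (n + n)%N = (i + (n + n - i))%N by have := ltn_ord i; lia.
  have le : ((n ^ 2 + n ^ 2).+1 <= i ^ 2 + (n + n - i) ^ 2)%N.
    by move: ni E; rewrite -val_eqE /=; nia.
  rewrite [X in wspan _ _ X]E.
  by apply: wspan_le le _; apply: wspanM; apply: wspan_gen.
rewrite !mulrA -signr_odd -[(-1) ^+ i]signr_odd -signr_addb -mulrA mulr_sign.
by case: ifP => _ //; apply: wspanN.
Qed.


End Generators.

(** * Leading terms of the Schur Q-functions *)

Lemma big_mate (T : Type) (idx : T) (op : Monoid.com_law idx) n (F : 'I_n -> T) :
  ~~ odd n ->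
  \big[op/idx]_(i < n | ~~ odd i) op (F i) (F (mate i)) = \big[op/idx]_(i < n) F i.
Proof.
move=> n_even; rewrite [RHS](bigID (fun i : 'I_n => ~~ odd i)) /= big_split /=.
congr (op _ _); rewrite [RHS](reindex_inj (mate_inj n_even)) /=.
by apply: eq_bigl => i; rewrite odd_mate // negbK.
Qed.

Lemma mate_even n (i : 'I_n) : ~~ odd i -> ordS i = mate i.
Proof. by move=> oi; rewrite /mate (negPf oi). Qed.

Section LeadingTerm.
Variables (K : fieldType) (R : comAlgType K) (q : nat -> R).
Hypothesis charK : [pchar K] =i pred0.

Definition pair_coef (r s : nat) : R :=
  q r * q s + 2%:R * \sum_(1 <= k < s.+1) (-1) ^+ k * q (r + k) * q (s - k).

Lemma pair_coef_lead r s : (s <= r)%N ->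
  wspan q predT (r + s) (r ^ 2 + s ^ 2).+1 (pair_coef r s - q r * q s).
Proof.
move=> sr; rewrite /pair_coef addrC addKr mulr_natl -scaler_nat; apply: wspanZ.
rewrite big_nat; apply: wspan_sum => k /andP[k0 ks].
have E : (r + s = (r + k) + (s - k))%N by lia.
have le : ((r ^ 2 + s ^ 2).+1 <= (r + k) ^ 2 + (s - k) ^ 2)%N by nia.
rewrite [X in wspan _ _ X]E -mulrA -signr_odd mulr_sign.
have W : wspan q predT (r + k + (s - k)) (r ^ 2 + s ^ 2).+1 (q (r + k) * q (s - k)).
  by apply: wspan_le le _; apply: wspanM; apply: wspan_gen.
by case: ifP => _ //; apply: wspanN.
Qed.

(** Modulo higher terms, [A i j] is the sign of j - i times q_(x i) q_(x j). Every [w] thus yields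
    the same monomial, the product of all q_(x i), with coefficient [pf_term w]; the total
    coefficient is the Pfaffian sum of ones. *)
Lemma pfaffian_lead n (x : 'I_n -> nat) (A : 'I_n -> 'I_n -> R) : ~~ odd n ->
    (forall i j : 'I_n, (i < j)%N -> (x j <= x i)%N) ->
    (forall i j : 'I_n, (i < j)%N -> A i j = pair_coef (x i) (x j)) ->
    (forall i j : 'I_n, (i < j)%N -> A j i = - pair_coef (x i) (x j)) ->
  exists2 c : K, c != 0 & wspan q predT (\sum_i x i)%N (\sum_i x i ^ 2)%N.+1
    (\sum_(w : 'S_n) (-1) ^+ w * \prod_(i < n | ~~ odd i) A (w i) (w (ordS i))
      - c *: \prod_i q (x i)).
Proof.
move=> n_even x_mono Alt Agt.
have [m m0 Em] := pfaffian_ones_gt0 n_even.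
exists m%:R; first exact: natf_neq0_pchar0.
have Alead i j : i != j -> wspan q predT (x i + x j) (x i ^ 2 + x j ^ 2).+1
    (A i j - (ord_sign i j)%:~R *: (q (x i) * q (x j))).
  move=> ij; rewrite ord_signE //; case: ltnP => [lt|].
    by rewrite scale1r Alt //; apply/pair_coef_lead/x_mono.
  rewrite leq_eqVlt eq_sym (negPf (_ : nat_of_ord i != j)) //= => gt.
  have -> : A i j - (-1) *: (q (x i) * q (x j)) =
      - (pair_coef (x j) (x i) - q (x j) * q (x i)).
    by rewrite Agt // scaleN1r mulrC opprB opprK addrC.
  by rewrite addnC [(_ ^ 2 + _)%N]addnC; apply/wspanN/pair_coef_lead/x_mono.
have term (w : 'S_n) : wspan q predT (\sum_i x i)%N (\sum_i x i ^ 2)%N.+1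
    (\prod_(i < n | ~~ odd i) A (w i) (w (ordS i))
      - (pf_term w)%:~R *: \prod_i q (x i)).
  (* Regroups the indices into the pairs matched by [w]. Any commutative law is allowed because it
     serves the weight, the sum of squares and the product of the q alike. *)
  have re (T : Type) (idx : T) (op : Monoid.com_law idx) (F : 'I_n -> T) :
      \big[op/idx]_i F i = \big[op/idx]_(i < n | ~~ odd i) op (F (w i)) (F (w (mate i))).
    by rewrite (reindex_perm w) /= -big_mate.
  rewrite !re [(pf_term w)%:~R]rmorph_prod.
  rewrite (eq_bigr (fun i => A (w i) (w (mate i)))); last first.
    by move=> i /mate_even ->.
  apply: wspan_prod_lead => i _.
    by apply: wspanM; apply: wspan_gen.
  by apply: Alead; rewrite (inj_eq perm_inj) eq_sym mate_neq.
have -> : \sum_(w : 'S_n) (-1) ^+ w * \prod_(i < n | ~~ odd i) A (w i) (w (ordS i))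
      - m%:R *: \prod_i q (x i) =
    \sum_(w : 'S_n) (-1) ^+ w * (\prod_(i < n | ~~ odd i) A (w i) (w (ordS i))
      - (pf_term w)%:~R *: \prod_i q (x i)).
  under [RHS]eq_bigr => w _ do rewrite mulrBr.
  rewrite sumrB; congr (_ - _).
  have -> : m%:R = \sum_(w : 'S_n) ((-1) ^+ w * pf_term w)%:~R :> K.
    by rewrite -rmorph_sum Em rmorph_nat.
  rewrite scaler_suml /=; apply: eq_bigr => w _.
  by rewrite rmorphM rmorph_sign !mulr_sign; case: ifP; rewrite ?scaleNr.
apply: wspan_sum => w _; rewrite mulr_sign; case: ifP => _ //.
exact: wspanN.
Qed.

End LeadingTerm.

(** Appending a zero part changes neither the product of the q, as q_0 = 1, nor the two sums. *)
Lemma big_nth_default (T : Type) (idx : T) (op : Monoid.law idx) (F : nat -> T) s e :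
  F 0%N = idx -> \big[op/idx]_(i < size s + e) F (nth 0%N s i) = \big[op/idx]_(a <- s) F a.
Proof.
move=> F0; rewrite (big_nth 0%N) big_mkord big_split_ord /=.
rewrite [X in op _ X]big1 ?Monoid.mulm1 // => i _.
by rewrite nth_default ?leq_addr.
Qed.

Section SchurSpan.
Variable K : fieldType.
Hypothesis charK : [pchar K] =i pred0.
Local Notation psum := (psum K).
Local Notation qfun := (qfun K).
Local Notation Qfun := (Qfun K).

Lemma Qfun_lead l : sorted geq l -> exists2 c : K, c != 0 &
  wspan qfun predT (sumn l) (sumsq l).+1 (Qfun l - c *: \prod_(a <- l) qfun a).
Proof.
move=> sl; pose n := (size l + odd (size l))%N.
have n_even : ~~ odd n by rewrite oddD oddb addbb.
pose x (i : 'I_n) := nth 0%N l i.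
have x_mono (i j : 'I_n) : (i < j)%N -> (x j <= x i)%N.
  move=> ij; rewrite /x; case: (ltnP j (size l)) => jl; last by rewrite nth_default.
  by have := sorted_leq_nth geq_trans leqnn 0%N sl; apply=> //; rewrite ?inE; lia.
have [//|i j ij|i j ij|c c0] := @pfaffian_lead _ _ qfun charK n x (Qmatrix K l) n_even.
- by rewrite mxE ij.
- by rewrite mxE ltnNge (ltnW ij) /= ij.
have q0 : qfun 0 = 1 by exact: odd_exp_coef0.
rewrite (big_nth_default _ _ _ (F := qfun)) // (big_nth_default _ _ _ (F := id)) //.
rewrite (big_nth_default _ _ _ (F := fun a => (a ^ 2)%N)) // -sumnE.
rewrite -(big_map (fun a => (a ^ 2)%N) xpredT id) -sumnE => W.
pose k : K := (2 ^ n./2 * (n./2)`!)%:R^-1; exists (k * c).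
  rewrite mulf_neq0 ?invr_eq0 // natf_neq0_pchar0 //.
  by rewrite muln_gt0 expn_gt0 fact_gt0.
by rewrite /Defs.Qfun /pfaffian -scalerA -scalerBr; apply: wspanZ.
Qed.

End SchurSpan.

(** * The Q_lambda span the products of the q_r *)

Lemma sumsq_le s : (sumsq s <= sumn s ^ 2)%N.
Proof.
elim: s => // a s IH; rewrite /sumsq /= sqrnD.
by rewrite (leq_trans _ (leq_addr _ _)) // leq_add2l.
Qed.

Lemma perm_duplicate (s : seq nat) : ~~ uniq s ->
  exists a, exists s', perm_eq s (a :: a :: s').
Proof.
elim: s => //= x s IH; rewrite negb_and negbK; case: (boolP (x \in s)) => [xs _|_ /IH].
  by exists x, (rem x s); rewrite perm_cons perm_to_rem.
move=> [a [s' ps]]; exists a, (x :: s').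
rewrite -(perm_cons x) in ps; apply: perm_trans ps _.
by rewrite -[x :: a :: _]/([:: x] ++ [:: a; a] ++ s') perm_catCA.
Qed.

Section SpanningByLeadingTerm.
Variables (K : fieldType) (R : comAlgType K) (p : nat -> R) (Qf : seq nat -> R).
Hypothesis charK : [pchar K] =i pred0.
Local Notation q := (odd_exp_coef p).
Hypothesis Qf_lead : forall l, sorted geq l -> exists2 c : K, c != 0 &
  wspan q predT (sumn l) (sumsq l).+1 (Qf l - c *: \prod_(a <- l) q a).

Definition in_spanQ N (g : R) : Prop :=
  exists c : seq nat -> K, g = \sum_(mu <- SP N) c mu *: Qf mu.

Lemma in_spanQ0 N : in_spanQ N 0.
Proof. by exists (fun=> 0); rewrite big1 // => mu _; rewrite scale0r. Qed.

Lemma in_spanQD N g h : in_spanQ N g -> in_spanQ N h -> in_spanQ N (g + h).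
Proof.
move=> [c ->] [d ->]; exists (fun mu => c mu + d mu).
by rewrite -big_split; apply: eq_bigr => mu _; rewrite scalerDl.
Qed.

Lemma in_spanQZ N a g : in_spanQ N g -> in_spanQ N (a *: g).
Proof.
move=> [c ->]; exists (fun mu => a * c mu).
by rewrite scaler_sumr; apply: eq_bigr => mu _; rewrite scalerA.
Qed.

Lemma in_spanQ_Qf N mu : mu \in SP N -> in_spanQ N (Qf mu).
Proof.
move=> muS; exists (fun nu => (nu == mu)%:R).
rewrite (bigD1_seq mu) ?uniq_SP //= eqxx scale1r big1 ?addr0 // => nu /negPf ->.
by rewrite scale0r.
Qed.

(* Downward induction on the sum of squares: a repeated part is removed by the
   quadratic relation, and a strict product is the leading term of some Q. *)
Lemma odd_exp_coef_prod_in_spanQ N s : sumn s = N -> in_spanQ N (\prod_(a <- s) q a).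
Proof.
(* [k] measures the distance to the maximum N^2 of the sum of squares, so k = 0 is impossible. *)
have [k] : exists k, (N ^ 2 < sumsq s + k)%N by exists (N ^ 2).+1; lia.
elim: k s => [|k IH] s; first by move=> lt sN; have := sumsq_le s; rewrite sN; lia.
move=> lt sN.
have higher g : wspan q predT N (sumsq s).+1 g -> in_spanQ N g.
  move=> [l [/allP al ->]]; rewrite big_seq; elim/big_rec: _ => [|x h /al].
    exact: in_spanQ0.
  move=> /and3P[_ /eqP Wx dx] hh; apply: in_spanQD => //; apply/in_spanQZ/IH => //.
  lia.
(* Zero entries are dropped, since q_0 = 1, so that [s'] is a partition of N. *)
pose s' := sort geq (filter (predC1 0%N) s).
have ps' : perm_eq s' (filter (predC1 0%N) s) by rewrite perm_sort.
have q0 : q 0 = 1 by exact: odd_exp_coef0.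
have dropz (T : Type) (idx : T) (op : Monoid.com_law idx) (F : nat -> T) :
    F 0%N = idx -> \big[op/idx]_(a <- s') F a = \big[op/idx]_(a <- s) F a.
  move=> F0; rewrite (perm_big _ ps') big_filter [RHS](bigID (predC1 0%N)) /=.
  by rewrite [X in op _ X]big1 ?Monoid.mulm1 // => i /negPn/eqP ->.
have s'N : sumn s' = N by rewrite sumnE (dropz _ _ _ id) // -sumnE.
have s'sq : sumsq s' = sumsq s.
  rewrite /sumsq !sumnE !big_map; exact: (dropz _ _ _ (fun a => a ^ 2)%N).
rewrite -(dropz _ _ _ q) //.
have ss' : sorted geq s' by apply: (sort_sorted geq_total).
have s'0 : 0%N \notin s' by rewrite (perm_mem ps') mem_filter.
have [us'|/perm_duplicate[a [t pt]]] := boolP (uniq s').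
  have [c c0] := Qf_lead ss'; rewrite s'N s'sq => /higher Hl.
  have S : s' \in SP N.
    by rewrite mem_SP gtn_sorted_uniq_geq us' ss' s'0 s'N eqxx.
  have := in_spanQZ c^-1 (in_spanQD (in_spanQ_Qf S) (in_spanQZ (-1) Hl)).
  by rewrite scaleN1r opprB addrCA subrr addr0 scalerA mulVf // scale1r.
rewrite (perm_big _ pt) /= !big_cons mulrA; apply: higher.
have a0 : (0 < a)%N.
  rewrite lt0n; apply: contraNneq s'0 => <-.
  by rewrite (perm_mem pt) mem_head.
rewrite -s'N -s'sq /sumsq (perm_sumn pt) (perm_sumn (perm_map _ pt)) /= !addnA.
rewrite -addSn; apply: wspanM; first exact: odd_exp_coef_square_wspan.
by apply: wspan_seq; rewrite ?all_predT.
Qed.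

End SpanningByLeadingTerm.

(** * The basis of power sum products *)

Lemma wspan_oddE (K : fieldType) (R : comAlgType K) (p : nat -> R) N g :
  wspan p odd N 0 g -> exists c : seq nat -> K,
  g = \sum_(al <- OP N) c al *: \prod_(a <- al) p a.
Proof.
move=> [l [/allP al ->]]; rewrite big_seq; elim/big_rec: _ => [|x h /al].
  by exists (fun=> 0); rewrite big1 // => ? _; rewrite scale0r.
move=> /and3P[ox Wx _] [c ->]; pose y := sort geq x.2.
have py : perm_eq x.2 y by rewrite perm_sym perm_sort.
have yO : y \in OP N.
  rewrite mem_OP (sort_sorted geq_total) -(perm_all _ py) ox.
  by rewrite -(perm_sumn py).
exists (fun be => (be == y)%:R * x.1 + c be).
under [RHS]eq_bigr => be _ do rewrite scalerDl.
rewrite big_split; congr (_ + _).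
rewrite (perm_big _ py) (bigD1_seq y) ?uniq_OP //= eqxx mul1r.
rewrite [X in _ + X]big1 ?addr0 // => be /negPf ->.
by rewrite mul0r scale0r.
Qed.


Lemma malgUM (K : fieldType) (m1 m2 : {cmonom nat}) :
  << m1 >> * << m2 >> = << mmul m1 m2 >> :> Gam K.
Proof. by rewrite malgM_def fgmulUU mul1r. Qed.

Lemma malgU_prod (K : fieldType) (I : Type) (r : seq I) (m : I -> {cmonom nat}) :
  \prod_(i <- r) (<< m i >> : Gam K) = << \big[mmul/mone]_(i <- r) m i >>.
Proof.
elim: r => [|i r IH]; first by rewrite !big_nil.
by rewrite !big_cons IH malgUM; exact: erefl.
Qed.

Definition pmonom (s : seq nat) : {cmonom nat} := \big[mmul/mone]_(a <- s) ucm a./2.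

Lemma pmonomE s i : pmonom s i = count (fun a => a./2 == i) s.
Proof.
elim: s => [|a s IH]; first by rewrite /pmonom big_nil cm1.
by rewrite /pmonom big_cons cmM -/(pmonom s) IH cmU.
Qed.

(** An odd part [a] is determined by [a./2], so the exponents record all multiplicities. *)
Lemma pmonom_inj N : {in OP N &, injective pmonom}.
Proof.
move=> s t; rewrite !mem_OP => /and3P[ss os _] /and3P[st ot _] E.
apply: (sorted_eq geq_trans geq_anti) => //; apply/allP => a _ /=; apply/eqP.
have H u : all odd u -> count_mem a u = if odd a then pmonom u a./2 else 0%N.
  rewrite pmonomE => /allP ou; case: ifP => oa.
    apply: eq_in_count => b /ou ob /=; apply/eqP/eqP => [->//|ab].
    by rewrite -(odd_double_half a) -(odd_double_half b) ab oa ob.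
  by apply/eqP; rewrite -leqn0 leqNgt -has_count; apply/negP => /hasP[b /ou ob /eqP ba];
    rewrite -ba ob in oa.
by rewrite !H // E.
Qed.

Section PowerSumBasis.
Variable K : fieldType.

Lemma psum_prodE s : \prod_(a <- s) psum K a = << pmonom s >>.
Proof. by rewrite /psum malgU_prod. Qed.

Lemma psum_prod_free N (c : seq nat -> K) :
  \sum_(al <- OP N) c al *: (\prod_(a <- al) psum K a) = 0 ->
  forall al, al \in OP N -> c al = 0.
Proof.
have coefE al be : (c be *: \prod_(a <- be) psum K a)@_(pmonom al) =
    c be * (pmonom be == pmonom al)%:R.
  by rewrite mcoeffZ psum_prodE mcoeffU.
move=> /malgP E al alO; have := E (pmonom al); rewrite mcoeff0 raddf_sum.
rewrite (eq_bigr _ (fun be _ => coefE al be)) (bigD1_seq al) ?uniq_OP //=.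
rewrite eqxx mulr1 big_seq_cond big1 ?addr0 // => be /andP[beO bal].
by rewrite (inj_in_eq (@pmonom_inj N)) // (negPf bal) mulr0.
Qed.

Lemma rescale_psum_prod (w : nat -> K) s : all odd s ->
  rescale w (\prod_(a <- s) psum K a) = (\prod_(a <- s) w a) *: \prod_(a <- s) psum K a.
Proof.
move=> os; rewrite rmorph_prod -scaler_prod big_seq [RHS]big_seq.
by apply: eq_bigr => a /(allP os) oa; rewrite /= rescale_psum.
Qed.

End PowerSumBasis.

(** * Transition matrices between the Q_lambda and the power sum products *)

Section TransitionMatrices.
Variable K : fieldType.

Lemma sum_nth_ord (V : zmodType) (s : seq (seq nat)) (F : seq nat -> V) :
  \sum_(x <- s) F x = \sum_(i < size s) F (nth [::] s i).
Proof. by rewrite (big_nth [::]) big_mkord. Qed.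

Definition psum_prod (s : seq nat) : Gam K := \prod_(a <- s) psum K a.

Lemma psum_prod_row_free N (u : 'rV[K]_(size (OP N))) :
  \sum_k u 0 k *: psum_prod (nth [::] (OP N) k) = 0 -> u = 0.
Proof.
move=> u0; pose c (al : seq nat) : K :=
  \sum_(k < size (OP N)) u 0 k * (nth [::] (OP N) k == al)%:R.
have cE (k : 'I_(size (OP N))) : c (nth [::] (OP N) k) = u 0 k.
  rewrite /c (bigD1 k) //= eqxx mulr1 big1 ?addr0 // => j jk.
  by rewrite nth_uniq ?uniq_OP // (negPf jk : (j == k :> nat) = false) mulr0.
apply/rowP => k; rewrite mxE -cE; apply: (@psum_prod_free K N); last exact: mem_nth.
rewrite sum_nth_ord -[RHS]u0; apply: eq_bigr => j _; rewrite cE; exact: erefl.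
Qed.

Hypothesis charK : [pchar K] =i pred0.

(** Expanding a power sum product in the Q and back gives B A = 1, because these products are
    independent. This forces |OP(N)| <= |SP(N)|, and Glaisher's map gives the reverse inequality. *)
Lemma Qfun_psum_transition N sp : perm_eq sp (SP N) -> size sp = size (OP N) /\
  exists (A : 'M[K]_(size sp, size (OP N))) (B : 'M[K]_(size (OP N), size sp)),
  [/\ forall i : 'I_(size sp), Qfun K (nth [::] sp i) =
        \sum_k A i k *: psum_prod (nth [::] (OP N) k),
      forall k : 'I_(size (OP N)), psum_prod (nth [::] (OP N) k) =
        \sum_i B k i *: Qfun K (nth [::] sp i)
    & B *m A = 1%:M].
Proof.
move=> psp.
have /fin_all_exists[A AE] (i : 'I_(size sp)) : exists u : 'I_(size (OP N)) -> K,
    Qfun K (nth [::] sp i) = \sum_k u k *: psum_prod (nth [::] (OP N) k).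
  have := mem_nth [::] (ltn_ord i); rewrite (perm_mem psp) mem_SP.
  move=> /and3P[/sorted_gtn_geq sl _ /eqP Nl].
  have [c _ /(wspan_le (leq0n _)) W] := Qfun_lead charK sl.
  have Wq : wspan (qfun K) predT N 0 (Qfun K (nth [::] sp i)).
    rewrite -[Qfun _ _](subrK (c *: \prod_(a <- nth [::] sp i) qfun K a)).
    rewrite Nl in W; apply: (wspanD W); apply: wspanZ; rewrite -[N in wspan _ _ N]Nl.
    by apply: wspan_seq; rewrite ?all_predT.
  have [d ->] := wspan_oddE (wspan_trans
    (fun n _ => odd_exp_coef_wspan (psum K) charK n) Wq).
  by exists (fun k => d (nth [::] (OP N) k)); rewrite sum_nth_ord.
have /fin_all_exists[B BE] (k : 'I_(size (OP N))) : exists u : 'I_(size sp) -> K,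
    psum_prod (nth [::] (OP N) k) = \sum_i u i *: Qfun K (nth [::] sp i).
  have := mem_nth [::] (ltn_ord k); rewrite mem_OP => /and3P[_ os /eqP Ns].
  have W : wspan (psum K) odd N 0 (psum_prod (nth [::] (OP N) k)).
    by rewrite -[N in wspan _ _ N]Ns; apply: wspan_seq.
  have [l [/allP al ->]] := wspan_trans
    (fun n => @power_sum_wspan K (Gam K) (psum K) charK n) W.
  have [d dE] : in_spanQ (Qfun K) N (\sum_(x <- l) x.1 *: \prod_(a <- x.2) qfun K a).
    rewrite big_seq; elim/big_rec: _ => [|x h /al /and3P[_ /eqP Wx _] hh].
      exact: in_spanQ0.
    apply: (in_spanQD _ hh); apply: in_spanQZ.
    exact: (odd_exp_coef_prod_in_spanQ charK (Qfun_lead charK) Wx).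
  exists (fun i => d (nth [::] sp i)); rewrite dE -(perm_big _ psp) sum_nth_ord.
  exact: erefl.
pose MA : 'M[K]_(size sp, size (OP N)) := \matrix_(i, k) A i k.
pose MB : 'M[K]_(size (OP N), size sp) := \matrix_(k, i) B k i.
have BA : MB *m MA = 1%:M.
  apply/row_matrixP => k; apply/eqP; rewrite -subr_eq0; apply/eqP.
  apply: psum_prod_row_free.
  under eq_bigr => j _ do rewrite !mxE scalerBl.
  rewrite sumrB; apply/eqP; rewrite subr_eq0; apply/eqP.
  transitivity (psum_prod (nth [::] (OP N) k)).
    rewrite [RHS]BE; under eq_bigr => j _ do rewrite scaler_suml.
    rewrite exchange_big; apply: eq_bigr => i _ /=; rewrite AE scaler_sumr.
    by apply: eq_bigr => j _; rewrite !mxE scalerA.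
  rewrite (bigD1 k) //= eqxx scale1r big1 ?addr0 // => j.
  by rewrite eq_sym => /negPf ->; rewrite scale0r.
split.
  apply/eqP; rewrite eqn_leq (mulmx1_min BA) andbT (perm_size psp).
  exact: size_SP_le.
exists MA, MB; split=> [i|k|]; last exact: BA.
  by rewrite AE; apply: eq_bigr => k _; rewrite mxE.
by rewrite BE; apply: eq_bigr => i _; rewrite mxE.
Qed.

End TransitionMatrices.

(** * Extension of scalars *)

Definition pair_entry (K : fieldType) (R : comAlgType K) (q : nat -> R)
    (l : seq nat) (i j : nat) : R :=
  if (i < j)%N then pair_coef q (nth 0%N l i) (nth 0%N l j)
  else if (j < i)%N then - pair_coef q (nth 0%N l j) (nth 0%N l i) else 0.

(** [Qfun] for an abstract sequence q in any algebra, a form through which ring morphisms can be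
    pushed. *)
Definition schur_pfaffian (K : fieldType) (R : comAlgType K) (q : nat -> R)
    (l : seq nat) : R :=
  let n := (size l + odd (size l))%N in
  ((2 ^ n./2 * (n./2)`!)%:R)^-1 *:
    \sum_(w : 'S_n) (-1) ^+ w *
      \prod_(i < n | ~~ odd i) pair_entry q l (w i) (w (ordS i)).

Lemma QmatrixE (K : fieldType) l i j :
  Qmatrix K l i j = pair_entry (qfun K) l i j.
Proof.
have QpairE r s : Qpair K r s = pair_coef (qfun K) r s by exact: erefl.
by rewrite /pair_entry -!QpairE mxE; exact: erefl.
Qed.

Lemma QfunE (K : fieldType) l : Qfun K l = schur_pfaffian (qfun K) l.
Proof.
rewrite /schur_pfaffian; apply: (congr1 ( *:%R _)).
apply: eq_bigr => w _; apply: (congr1 ( *%R _)).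
by apply: eq_bigr => i _; apply: QmatrixE.
Qed.

Section SemilinearMorphism.
Variables (K L : fieldType) (f : {rmorphism K -> L}).
Variables (R : comAlgType K) (S : comAlgType L) (phi : {rmorphism R -> S}).
Hypothesis phiZ : forall c g, phi (c *: g) = f c *: phi g.

Lemma map_odd_exp_coef (p : nat -> R) (p' : nat -> S) :
  (forall n, odd n -> phi (p n) = p' n) ->
  forall r, phi (odd_exp_coef p r) = odd_exp_coef p' r.
Proof.
move=> pp' r.
have E : map_poly phi (odd_exponent p r) = odd_exponent p' r.
  apply/polyP => i; rewrite coef_map !coef_odd_exponent.
  case: ifP => [/andP[_ oi]|_]; last exact: rmorph0.
  by rewrite /= phiZ pp' // fmorph_div !rmorph_nat.
rewrite /odd_exp_coef rmorph_sum; apply: eq_bigr => k _.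
by rewrite phiZ fmorphV rmorph_nat -coef_map rmorphXn /= E.
Qed.

Lemma map_schur_pfaffian (q : nat -> R) (q' : nat -> S) :
  (forall n, phi (q n) = q' n) ->
  forall l, phi (schur_pfaffian q l) = schur_pfaffian q' l.
Proof.
move=> qq' l.
have map_pair r s : phi (pair_coef q r s) = pair_coef q' r s.
  rewrite /pair_coef rmorphD !rmorphM !qq' rmorph_nat; congr (_ + _ * _).
  rewrite rmorph_sum; apply: eq_bigr => k _.
  by rewrite !rmorphM !qq' rmorphXn rmorphN1.
rewrite /schur_pfaffian phiZ fmorphV rmorph_nat; congr (_ *: _).
rewrite rmorph_sum; apply: eq_bigr => w _; rewrite rmorphM rmorph_sign; congr (_ * _).
rewrite rmorph_prod; apply: eq_bigr => i _; rewrite /pair_entry.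
by case: ifP => _ //; case: ifP => _; rewrite ?rmorphN ?rmorph0 //; congr (- _).
Qed.

End SemilinearMorphism.

Section BaseChange.
Variables (K L : fieldType) (f : {rmorphism K -> L}).

Definition base_monom (m : {cmonom nat}) : Gam L := << m >>.

Lemma base_monom_mmorphism : mmorphism base_monom.
Proof. by split=> [m1 m2|] //; rewrite /base_monom -malgUM; exact: erefl. Qed.

HB.instance Definition _ :=
  isMultiplicative.Build {cmonom nat} (Gam L) base_monom base_monom_mmorphism.

(** The scalars in the definition of Q_lambda are rational, so [f] fixes them. Transition matrices
    over [K] therefore stay valid over [L] after applying [f] to their entries. *)
Definition base_change : Gam K -> Gam L := mmap (malgC \o f) base_monom.

HB.instance Definition _ := GRing.RMorphism.on base_change.

Lemma base_changeZ c g : base_change (c *: g) = f c *: base_change g.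
Proof. by rewrite /base_change mmapZ /= mul_malgC. Qed.

Lemma base_change_psum n : base_change (psum K n) = psum L n.
Proof. by rewrite /base_change mmapU /= rmorph1 mul1r. Qed.

Lemma base_change_Qfun l : base_change (Qfun K l) = Qfun L l.
Proof.
rewrite !QfunE; apply: (map_schur_pfaffian base_changeZ) => n.
by apply: (map_odd_exp_coef base_changeZ) => m _; apply: base_change_psum.
Qed.

Lemma base_change_psum_prod s : base_change (psum_prod K s) = psum_prod L s.
Proof.
by rewrite /psum_prod rmorph_prod; apply: eq_bigr => a _; apply: base_change_psum.
Qed.

End BaseChange.

(** * The rescaling map in the basis of the Q_lambda *)

Lemma mulmx1_comm (F : fieldType) n o (A : 'M[F]_(n, o)) (B : 'M[F]_(o, n)) :
  n = o -> B *m A = 1%:M -> A *m B = 1%:M.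
Proof. by move=> E; case: o / E A B => A B; apply: mulmx1C. Qed.

Lemma det_mulmx_conj (F : fieldType) n o (A : 'M[F]_(n, o)) (B : 'M[F]_(o, n)) D :
  n = o -> B *m A = 1%:M -> \det (A *m D *m B) = \det D.
Proof.
move=> E; case: o / E A B D => A B D BA.
by rewrite !det_mulmx mulrAC -det_mulmx (mulmx1C BA) det1 mul1r.
Qed.

Section RescaleCoefficients.
Variables (L : fieldType) (N : nat) (sp : seq (seq nat)).
Variables (A : 'M[L]_(size sp, size (OP N))) (B : 'M[L]_(size (OP N), size sp)).
Hypothesis psp : perm_eq sp (SP N).
Hypothesis size_sp : size sp = size (OP N).
Hypothesis QE : forall i : 'I_(size sp),
  Qfun L (nth [::] sp i) = \sum_k A i k *: psum_prod L (nth [::] (OP N) k).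
Hypothesis pE : forall k : 'I_(size (OP N)),
  psum_prod L (nth [::] (OP N) k) = \sum_i B k i *: Qfun L (nth [::] sp i).
Hypothesis BA : B *m A = 1%:M.

Lemma Qfun_row_free (u : 'rV[L]_(size sp)) :
  \sum_i u 0 i *: Qfun L (nth [::] sp i) = 0 -> u = 0.
Proof.
move=> u0; rewrite -[u]mulmx1 -(mulmx1_comm size_sp BA) mulmxA.
suff -> : u *m A = 0 by rewrite mul0mx.
apply: psum_prod_row_free; rewrite -[RHS]u0.
under [RHS]eq_bigr => i _ do rewrite QE scaler_sumr.
rewrite exchange_big; apply: eq_bigr => k _ /=; rewrite mxE scaler_suml.
by apply: eq_bigr => i _; rewrite scalerA.
Qed.

Variable w : nat -> L.

Definition rescale_mx : 'M[L]_(size sp) :=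
  A *m diag_mx (\row_k \prod_(a <- nth [::] (OP N) k) w a) *m B.

Lemma rescale_QfunE (i : 'I_(size sp)) :
  rescale w (Qfun L (nth [::] sp i)) =
    \sum_j rescale_mx i j *: Qfun L (nth [::] sp j).
Proof.
rewrite QE rmorph_sum.
transitivity (\sum_k (A i k * \prod_(a <- nth [::] (OP N) k) w a) *:
    psum_prod L (nth [::] (OP N) k)).
  apply: eq_bigr => k _; rewrite /= rescaleZ -scalerA; congr (_ *: _).
  apply: rescale_psum_prod.
  by have := mem_nth [::] (ltn_ord k); rewrite mem_OP => /and3P[].
under eq_bigr => k _ do rewrite pE scaler_sumr.
rewrite exchange_big; apply: eq_bigr => j _ /=.
rewrite /rescale_mx mxE scaler_suml; apply: eq_bigr => k _.
by rewrite scalerA mul_mx_diag !mxE.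
Qed.

(** The forward direction identifies whatever coefficients a choice operator returns; the converse
    shows that such coefficients exist. *)
Lemma rescale_Qfun_coefP (i : 'I_(size sp)) (c : seq nat -> L) :
  rescale w (Qfun L (nth [::] sp i)) = \sum_(mu <- SP N) c mu *: Qfun L mu <->
  forall j : 'I_(size sp), c (nth [::] sp j) = rescale_mx i j.
Proof.
rewrite -(perm_big _ psp) sum_nth_ord rescale_QfunE; split=> E.
  pose u := \row_j (c (nth [::] sp j) - rescale_mx i j).
  have u0 : u = 0.
    apply: Qfun_row_free; under eq_bigr => j _ do rewrite mxE scalerBl.
    rewrite sumrB; apply/eqP; rewrite subr_eq0; apply/eqP; exact: esym E.
  move=> j; have := congr1 (fun v : 'rV_(size sp) => v 0 j) u0.
  by rewrite !mxE => /eqP; rewrite subr_eq0 => /eqP.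
by apply: eq_bigr => j _; rewrite E; exact: erefl.
Qed.

End RescaleCoefficients.

(** * Eigenvalues, q-integers and cyclotomic polynomials *)

Lemma pchar_Qt : [pchar Qt] =i pred0.
Proof.
move=> x; rewrite (fmorph_pchar (@tofrac {poly rat} \o polyC)).
exact: pchar_num.
Qed.

Lemma tvarX_neq1 a : (0 < a)%N -> tvar ^+ a != 1.
Proof.
move=> a0; rewrite /tvar -tofracXn -tofrac1 tofrac_eq.
by apply/eqP => /(congr1 (fun u : {poly rat} => size u));
  rewrite size_polyXn size_poly1; case: a a0.
Qed.

Lemma ratfun_eval_tofrac (F : fieldType) (p : {poly F}) x :
  ratfun_eval (tofrac p) x = p.[x].
Proof.
have := @ratfun_evalE F p 1 x; rewrite tofrac1 divr1 hornerC oner_neq0 divr1.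
exact.
Qed.

Lemma qint_sub1 M x : (x - 1) * qint M x = x ^+ M - 1.
Proof. by rewrite /qint -subrX1. Qed.

Lemma qintE M x : x != 1 -> qint M x = (1 - x ^+ M) / (1 - x).
Proof.
move=> x1; have x10 : 1 - x != 0 by rewrite subr_eq0 eq_sym.
by apply: (mulIf x10); rewrite divfK // -opprB mulrN mulrC qint_sub1 opprB.
Qed.

Lemma Cyclotomic1 : 'Phi_1 = 'X - 1.
Proof. by rewrite -[RHS](prod_Cyclotomic (ltn0Sn 0)) big_seq1. Qed.

(** Multiplied by x - 1, both sides become x^M - 1, the factor x - 1 being the value of the first
    cyclotomic polynomial. *)
Lemma qint_Cyclotomic M x : (0 < M)%N -> x != 1 ->
  qint M x = \prod_(d <- divisors M | (1 < d)%N) (map_poly intr 'Phi_d).[x].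
Proof.
move=> M0 x1; have x10 : x - 1 != 0 by rewrite subr_eq0.
apply: (mulfI x10); rewrite qint_sub1.
have := congr1 (fun u : {poly int} => (map_poly intr u).[x]) (prod_Cyclotomic M0).
rewrite /= rmorph_prod horner_prod rmorphB rmorph1 /= map_polyXn hornerD hornerN.
rewrite hornerXn hornerC => <-.
have M1 : 1%N \in divisors M by rewrite -dvdn_divisors.
rewrite (bigD1_seq 1%N) ?divisors_uniq //= Cyclotomic1 rmorphB rmorph1 /= map_polyX.
rewrite hornerD hornerN hornerX hornerC; congr (_ * _).
rewrite big_seq_cond [RHS]big_seq_cond; apply: eq_bigl => d.
have [/= dM|//] := boolP (d \in divisors M).
rewrite -dvdn_divisors // in dM.
by have := dvdn_gt0 M0 dM; lia.
Qed.

Lemma tofrac_eigenvalue (F : fieldType) (s : F) a :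
  tofrac ((1 - 'X^a) * ((1 - s ^+ a)^-1)%:P) =
    (1 - tofrac 'X ^+ a) / (1 - tofrac s%:P ^+ a).
Proof.
rewrite tofracM tofracB tofrac1 tofracXn; congr (_ * _).
have -> : 1 - tofrac s%:P ^+ a = tofrac (1 - s ^+ a)%:P.
  by rewrite polyCB polyC_exp tofracB tofrac1 tofracXn.
exact: (fmorphV (@tofrac {poly F} \o polyC)).
Qed.

Lemma horner_eigenvalue (F : fieldType) (s : F) a M :
  ((1 - 'X^a) * ((1 - s ^+ a)^-1)%:P).[s ^+ M] = (1 - s ^+ a ^+ M) / (1 - s ^+ a).
Proof. by rewrite hornerM hornerC !hornerE -!exprM mulnC. Qed.

(* The eigenvalue of T_{t,s} on a product of power sums, as a polynomial in t. *)
Definition rescale_eigen (F : fieldType) (s : F) (al : seq nat) : {poly F} :=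
  \prod_(a <- al) ((1 - 'X^a) * ((1 - s ^+ a)^-1)%:P).

(** * The coefficients as polynomials in t, and the determinant *)

(** [F] contains s but not t, and [A] and [B] live over [F]. Only the eigenvalues involve t, and
    they are polynomial in it. *)
Lemma Tmap_coefP (F : fieldType) (s : F) N sp :
    [pchar F] =i pred0 -> perm_eq sp (SP N) ->
  size sp = size (OP N) /\
  exists (A : 'M[F]_(size sp, size (OP N))) (B : 'M[F]_(size (OP N), size sp)),
    B *m A = 1%:M /\
    forall (i : 'I_(size sp)) (c : seq nat -> {fraction {poly F}}),
      Tmap (tofrac 'X) (tofrac s%:P) (Qfun _ (nth [::] sp i)) =
        \sum_(mu <- SP N) c mu *: Qfun _ mu <->
      forall j : 'I_(size sp), c (nth [::] sp j) =
        tofrac (\sum_k (A i k)%:P * rescale_eigen s (nth [::] (OP N) k) * (B k j)%:P).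
Proof.
move=> charF psp; have [size_sp [A [B [QE pE BA]]]] := Qfun_psum_transition charF psp.
split=> //; exists A, B; split=> // i c.
pose L := {fraction {poly F}}.
pose f : {rmorphism F -> L} := (@tofrac {poly F} \o polyC).
have fQE (i' : 'I_(size sp)) : Qfun L (nth [::] sp i') =
    \sum_k map_mx f A i' k *: psum_prod L (nth [::] (OP N) k).
  rewrite -(base_change_Qfun f) QE rmorph_sum; apply: eq_bigr => k _.
  by rewrite /= base_changeZ base_change_psum_prod mxE; exact: erefl.
have fpE (k : 'I_(size (OP N))) : psum_prod L (nth [::] (OP N) k) =
    \sum_i map_mx f B k i *: Qfun L (nth [::] sp i).
  rewrite -(base_change_psum_prod f) pE rmorph_sum; apply: eq_bigr => j _.
  by rewrite /= base_changeZ base_change_Qfun mxE; exact: erefl.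
have fBA : map_mx f B *m map_mx f A = 1%:M by rewrite -map_mxM BA map_mx1.
pose w a : L := (1 - tofrac 'X ^+ a) / (1 - tofrac s%:P ^+ a).
have RE j : rescale_mx (map_mx f A) (map_mx f B) w i j =
    tofrac (\sum_k (A i k)%:P * rescale_eigen s (nth [::] (OP N) k) * (B k j)%:P).
  rewrite /rescale_mx mxE rmorph_sum; apply: eq_bigr => k _.
  rewrite mul_mx_diag !mxE /= !tofracM; congr (_ * _ * _).
  by rewrite /rescale_eigen rmorph_prod; apply: eq_bigr => a _; rewrite /= tofrac_eigenvalue.
have coefP := rescale_Qfun_coefP psp size_sp fQE fpE fBA w i c.
apply: (iff_trans coefP); split=> H j; first by rewrite H RE.
by rewrite H RE.
Qed.

Lemma horner_rescale_eigen M N al : al \in OP N ->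
  (rescale_eigen tvar al).[tvar ^+ M] = \prod_(a <- al) qint M (tvar ^+ a).
Proof.
rewrite mem_OP => /and3P[_ /allP oal _].
rewrite /rescale_eigen horner_prod [LHS]big_seq [RHS]big_seq.
apply: eq_bigr => a /oal oa; rewrite qintE; last by rewrite tvarX_neq1 ?odd_gt0.
exact: horner_eigenvalue.
Qed.

Lemma horner_mulmx_diag (F : fieldType) n o (A : 'M[F]_(n, o)) (B : 'M[F]_(o, n))
    (E : 'I_o -> {poly F}) x i j :
  (\sum_k (A i k)%:P * E k * (B k j)%:P).[x] =
    (A *m diag_mx (\row_k (E k).[x]) *m B) i j.
Proof.
rewrite horner_sum mxE; apply: eq_bigr => k _.
by rewrite mul_mx_diag !mxE !hornerM !hornerC.
Qed.

Lemma CMmatrix_det M N sp : perm_eq sp (SP N) ->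
  \det (CMmatrix M sp) = \prod_(al <- OP N) \prod_(a <- al) qint M (tvar ^+ a).
Proof.
move=> psp; have [size_sp [A [B [BA coefP]]]] := Tmap_coefP tvar pchar_Qt psp.
pose E k := rescale_eigen tvar (nth [::] (OP N) k).
pose R i j := tofrac (\sum_k (A i k)%:P * E k * (B k j)%:P).
have CE (i j : 'I_(size sp)) : Ccoef (nth [::] sp i) (nth [::] sp j) = R i j.
  have Ni : sumn (nth [::] sp i) = N.
    have := mem_nth [::] (ltn_ord i).
    by rewrite (perm_mem psp) mem_SP => /and3P[_ _ /eqP].
  rewrite /Ccoef Ni; set P := (fun c : seq nat -> Qts => _).
  suff ex : exists c, P c.
    exact: (proj1 (coefP i _) (ClassicalEpsilon.epsilon_spec (inhabits (fun=> 0)) P ex)).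
  (* Turns the row i of [R] into a function on partitions; [sp] has no repetition, so its value at
     the j-th partition is [R i j]. *)
  exists (fun mu => \sum_(j < size sp) (nth [::] sp j == mu)%:R * R i j).
  apply: (proj2 (coefP i _)) => k.
  rewrite (bigD1 k) //= eqxx mul1r big1 ?addr0 // => l lk.
  rewrite nth_uniq ?(perm_uniq psp) ?uniq_SP //.
  by rewrite (negPf lk : (l == k :> nat) = false) mul0r.
have -> : CMmatrix M sp = A *m diag_mx (\row_k (E k).[tvar ^+ M]) *m B.
  apply/matrixP => i j; rewrite mxE /CMcoef CE ratfun_eval_tofrac.
  exact: horner_mulmx_diag.
rewrite det_mulmx_conj // det_diag [RHS](big_nth [::]) big_mkord.
apply: eq_bigr => k _; rewrite mxE /E (@horner_rescale_eigen M N) //.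
exact: mem_nth.
Qed.

(* sp is any ordering of SP(N). *)
Theorem theorem4p6 (M N : nat) (sp : seq (seq nat)) :
  (0 < M)%N -> perm_eq sp (SP N) ->
  \det (CMmatrix M sp) =
    \prod_(alpha <- OP N) \prod_(a <- alpha) qint M (tvar ^+ a)
  /\
  \det (CMmatrix M sp) =
    \prod_(alpha <- OP N) \prod_(a <- alpha) \prod_(d <- divisors M | (1 < d)%N)
      (map_poly intr 'Phi_d).[tvar ^+ a].
Proof.
move=> M0 psp; rewrite (CMmatrix_det M psp); split=> //.
rewrite big_seq [RHS]big_seq; apply: eq_bigr => al.
rewrite mem_OP => /and3P[_ /allP oal _]; rewrite big_seq [RHS]big_seq.
apply: eq_bigr => a /oal oa; apply: qint_Cyclotomic => //.
by rewrite tvarX_neq1 ?odd_gt0.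
Qed.
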